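(* Let $(V,g)$ be an inner product vector space over $k$, with $k=\mathbb{R}$ or $k=\mathbb{C}$ (possibly infinite-dimensional), and let $\varphi,\psi\in\operatorname{End}_k(V)$ be finite potent endomorphisms with $i(\varphi)\le 1$ and $i(\psi)\le 1$. Let $V=W_\varphi\oplus U_\varphi=\operatorname{Im}(\varphi)\oplus\operatorname{Ker}(\varphi)$ be the AST-decomposition of $V$ induced by $\varphi$. Then $$\varphi\leq^{(\#)}\psi\quad\text{if and only if}\quad \varphi|_{\operatorname{Im}(\varphi)}=\psi|_{\operatorname{Im}(\varphi)}\ \text{ and }\ \psi(\operatorname{Ker}(\varphi))\subseteq[\operatorname{Im}(\varphi)]^{\perp}.$$
   Context: An endomorphism $\varphi$ of $V$ is finite potent if $\varphi^n(V)$ is finite-dimensional for some $n$. Equivalently, there is a (unique) $\varphi$-invariant decomposition $V=W_\varphi\oplus U_\varphi$ (AST-decomposition) with $\varphi|_{U_\varphi}$ nilpotent, $W_\varphi$ finite-dimensional and $\varphi|_{W_\varphi}$ an automorphism of $W_\varphi$. The index $i(\varphi)$ is the nilpotency order of $\varphi|_{U_\varphi}$; $i(\varphi)\le 1$ iff $W_\varphi=\operatorname{Im}(\varphi)$ iff $U_\varphi=\operatorname{Ker}(\varphi)$. For $\varphi$ finite potent with $i(\varphi)\le 1$ one has $V=\operatorname{Im}(\varphi)\oplus[\operatorname{Im}(\varphi)]^{\perp}$, and the core inverse $\varphi^{(\#)}$ is the unique linear map with $\varphi\circ\varphi^{(\#)}=P_{\operatorname{Im}(\varphi)}$ (the orthogonal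 projection onto $\operatorname{Im}(\varphi)$ induced by this decomposition) and $\operatorname{Im}(\varphi^{(\#)})\subseteq\operatorname{Im}(\varphi)$. For finite potent $\varphi,\psi$ of index $\le1$, the core order $\varphi\leq^{(\#)}\psi$ means: $\varphi\circ\varphi^{(\#)}=\psi\circ\varphi^{(\#)}$ and $\varphi^{(\#)}\circ\varphi=\varphi^{(\#)}\circ\psi$. *)

(* Defs.v *)
From mathcomp Require Import all_boot all_order all_algebra.
From mathcomp Require Import classical_sets functions reals.
From mathcomp Require Import complex.

Set Implicit Arguments.
Unset Strict Implicit.
Unset Printing Implicit Defensive.

Import Order.TTheory GRing.Theory Num.Theory.

Local Open Scope classical_set_scope.
Local Open Scope ring_scope.

Inductive scalar_kind := RealScalars | ComplexScalars.

Definition scalars (R : realType) (k : scalar_kind) : numFieldType :=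
  match k with
  | RealScalars => R
  | ComplexScalars => R[i]
  end.

(* {dot V for scalar_conj R k} is the type of inner products on V: symmetric
   bilinear forms over R, hermitian sesquilinear forms over R[i] (linear in the
   first argument), positive definite in both cases. *)
Definition scalar_conj (R : realType) (k : scalar_kind) :
    scalars R k -> scalars R k :=
  match k with
  | RealScalars => idfun
  | ComplexScalars => Num.conj
  end.

Section LinearAlgebra.
Variables (K : numFieldType) (V : lmodType K).
Implicit Types (phi : {linear V -> V}) (S W U : set V) (n : nat).

Definition ker phi : set V := phi @^-1` [set 0].

Definition subspace S : Prop := submod_closed (mem S).

Definition finite_dim S : Prop :=
  exists (n : nat) (e : 'I_n -> V),
    (forall i, S (e i)) /\
    (forall v, S v -> exists c : 'I_n -> K, v = \sum_(i < n) c i *: e i).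

Definition direct_sum W U : Prop :=
  (forall v, exists2 w, W w & exists2 u, U u & v = w + u) /\
  W `&` U = [set 0].

Definition finite_potent phi : Prop :=
  exists n, finite_dim (range (iter n phi)).

Definition vanishes_on phi U n : Prop := forall u, U u -> iter n phi u = 0.

Record AST_decomposition phi W U : Prop := {
  AST_subspace_W : subspace W;
  AST_subspace_U : subspace U;
  AST_direct_sum : direct_sum W U;
  AST_invariant_U : phi @` U `<=` U;
  AST_nilpotent_U : exists n, vanishes_on phi U n;
  AST_finite_dim_W : finite_dim W;
  AST_automorphism_W : set_bij W W phi (* includes invariance of W *)
}.

(* The zero map of the zero space has nilpotency order 0, so that
   automorphisms of finite-dimensional spaces have index 0. *)
Definition nilpotency_order phi U n : Prop :=
  vanishes_on phi U n /\ forall m, vanishes_on phi U m -> (n <= m)%N.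

(* The graph of the index i(phi) = n; it is functional because the
   AST-decomposition is unique. *)
Definition has_index phi n : Prop :=
  exists W U, AST_decomposition phi W U /\ nilpotency_order phi U n.

End LinearAlgebra.

Section CoreOrder.
Variables (K : numFieldType) (V : lmodType K) (conj : K -> K).
Variable g : {dot V for conj}.
Implicit Types (phi psi chi : {linear V -> V}) (S : set V).

Definition orthocomp S : set V := [set v | forall s, S s -> g v s = 0].

(* p is the projection onto S along orthocomp S. *)
Definition orthogonal_projection S (p : V -> V) : Prop :=
  forall v, S (p v) /\ orthocomp S (v - p v).

Definition is_core_inverse phi chi : Prop :=
  orthogonal_projection (range phi) (phi \o chi) /\
  range chi `<=` range phi.

(* The core inverse of phi is unique, hence the existential only names it; its
   existence is part of what has to be proved to establish the order. *)
Definition core_le phi psi : Prop :=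
  exists chi, [/\ is_core_inverse phi chi,
                  phi \o chi =1 psi \o chi &
                  chi \o phi =1 chi \o psi].

End CoreOrder.

(* Main.v *)
From HB Require Import structures.
Require Import Defs.
From mathcomp Require Import all_boot all_order all_algebra.
From mathcomp Require Import boolp classical_sets functions reals.

Set Implicit Arguments.
Unset Strict Implicit.
Unset Printing Implicit Defensive.

Import Order.TTheory GRing.Theory.

Local Open Scope classical_set_scope.
Local Open Scope ring_scope.

(** An endomorphism of index at most 1 restricts to a bijection of its image,
which is finite-dimensional and complementary to the kernel. Hence for every v
there is exactly one x in the image of phi with v - phi x orthogonal to the
image, and the core inverse chi is the map v |-> x. It inverts phi on the image
and its kernel is the orthogonal complement of the image: the first equation of
the core order says that phi and psi agree on the image of chi, which is the
image of phi, and the second one, evaluated on the kernel of phi, says that psi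
maps this kernel into the kernel of chi. *)

Lemma AST_decomposition_index_le1 (K : numFieldType) (V : lmodType K)
    (phi : {linear V -> V}) (i : nat) :
  has_index phi i -> (i <= 1)%N ->
  AST_decomposition phi (range phi) (ker phi).
Proof.
move=> [W [U [AST [nilU _]]]] i_le1.
have [subW _ [VWU _] _ _ _ [phiW injW surjW]] := AST.
have [/set_mem W0 _] := subW.
have phiU u : U u -> phi u = 0.
  (* For index 0 the hypothesis reads [u = 0], for index 1 it reads [phi u = 0]. *)
  by move=> /nilU; case: i i_le1 {nilU} => [|[|//]] _ //= ->; rewrite linear0.
have kerE : U = ker phi.
  apply/seteqP; split=> [u /phiU //|v phiv0].
  have [w Ww [u Uu def_v]] := VWU v.
  suff w0 : w = 0 by rewrite def_v w0 add0r.
  apply: injW; rewrite ?inE // linear0.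
  by have := phiv0; rewrite def_v /ker /= linearD (phiU u Uu) addr0.
have rangeE : W = range phi.
  apply/seteqP; split=> [w /surjW [x _ <-]|_ [v _ <-]]; first by exists x.
  have [w Ww [u Uu ->]] := VWU v.
  by rewrite linearD (phiU u Uu) addr0; apply: phiW.
by rewrite -kerE -rangeE.
Qed.

Section InnerProduct.
Context {K : numFieldType} {V : lmodType K} {conj : K -> K}.
Variable g : {dot V for conj}.

Lemma dotC x y : g x y = conj (g y x).
Proof. by rewrite (hermitian_subproof (s := g)) expr0 mul1r. Qed.

Lemma dot_eq0_sym x y : g x y = 0 -> g y x = 0.
Proof.
(* [conj] is an arbitrary map here; its value at 0 is forced by the symmetry of [g]. *)
have conj0 : conj 0 = 0 by have := dotC 0 0; rewrite linear0l => <-.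
by move=> xy0; rewrite dotC xy0 conj0.
Qed.

Lemma dot_self_eq0 x : g x x = 0 -> x = 0.
Proof.
move=> xx0; apply/eqP; apply: contraT => /(neq0_dnorm_gt0 (s := g)).
by rewrite xx0 ltxx.
Qed.

Lemma orthocomp_lin (S : set V) (a : K) x y :
  orthocomp g S x -> orthocomp g S y -> orthocomp g S (a *: x + y).
Proof. by move=> Sx Sy s Ss; rewrite linearPl /= Sx // Sy // mulr0 addr0. Qed.

(* The last conjunct replaces "p is in the span of s". *)
Lemma orthogonalize_seq (S : set V) (s : seq V) (v : V) :
  subspace S -> (forall x, x \in s -> S x) ->
  exists p, [/\ S p, forall x, x \in s -> g (v - p) x = 0 &
    forall w, (forall x, x \in s -> g x w = 0) -> g p w = 0].
Proof.
move=> [/set_mem S0 linS]; elim: s v => [|x s IHs] v Ss.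
  by exists 0; split=> // w _; rewrite linear0l.
have Slin a y z : S y -> S z -> S (a *: y + z).
  by move=> Sy Sz; apply/set_mem/linS; rewrite inE.
have {}IHs w : exists p, [/\ S p, forall x, x \in s -> g (w - p) x = 0 &
    forall w, (forall x, x \in s -> g x w = 0) -> g p w = 0].
  by apply: IHs => y sy; apply: Ss; rewrite inE sy orbT.
have [p [Sp orth_p span_p]] := IHs v.
have [q [Sq orth_q span_q]] := IHs x.
(* If [x = q], then [x] depends on [s] and [p] already works, so the family need not be free. *)
have [xq0|xq0] := eqVneq (x - q) 0.
  exists p; split=> // [y|w orth_w]; last first.
    by apply: span_p => y sy; apply: orth_w; rewrite inE sy orbT.
  rewrite inE => /orP[/eqP->|]; last exact: orth_p.
  have -> : x = q by apply/eqP; rewrite -subr_eq0 xq0.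
  by apply/dot_eq0_sym/span_q => z sz; apply/dot_eq0_sym/orth_p.
(* Gram-Schmidt step: [r] is the part of [x] orthogonal to [s], and [c] makes [v - (c *: r + p)]
   orthogonal to [r]. *)
set r := x - q in xq0 orth_q; pose c := g (v - p) r / g r r.
have rr0 : g r r != 0 by apply: contra xq0 => /eqP/dot_self_eq0->.
have Sr : S r.
  by rewrite /r addrC -scaleN1r; apply: Slin => //; apply: Ss; rewrite mem_head.
have vE : v - (c *: r + p) = (- c) *: r + (v - p).
  by rewrite scaleNr opprD addrCA.
have orth_s y : y \in s -> g (v - (c *: r + p)) y = 0.
  by move=> sy; rewrite vE linearPl /= orth_q // orth_p // mulr0 addr0.
exists (c *: r + p); split=> [|y|w orth_w]; first exact: Slin.
  rewrite inE => /orP[/eqP->|/orth_s //].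
  have -> : x = r + q by rewrite subrK.
  rewrite linearDr /= [X in _ + X]dot_eq0_sym ?addr0; last first.
    by apply: span_q => z sz; apply/dot_eq0_sym/orth_s.
  by rewrite vE linearPl /= mulNr divfK // addNr.
have orth_sw y : y \in s -> g y w = 0.
  by move=> sy; apply: orth_w; rewrite inE sy orbT.
by rewrite linearPl /= linearBl /= orth_w ?mem_head // span_q // span_p //
  subr0 mulr0 addr0.
Qed.

Lemma orthogonal_projection_exists (S : set V) (v : V) :
  subspace S -> finite_dim S -> exists2 p, S p & orthocomp g S (v - p).
Proof.
move=> subS [n [e [Se spanS]]].
have [x /mapP[i _ ->] // | p [Sp orth_p _]] :=
  @orthogonalize_seq S [seq e i | i <- enum 'I_n] v subS.
exists p => // s /spanS[c ->].
apply: dot_eq0_sym; rewrite linear_sumlz big1 // => i _.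
rewrite linearZl_LR /= dot_eq0_sym ?mulr0 //.
by apply: orth_p; rewrite map_f // mem_enum.
Qed.

Section CoreInverse.
Variable phi : {linear V -> V}.
Hypothesis AST_phi : AST_decomposition phi (range phi) (ker phi).

Lemma range_linear a x y : range phi x -> range phi y -> range phi (a *: x + y).
Proof.
by move=> [x' _ <-] [y' _ <-]; exists (a *: x' + y'); rewrite ?linearP.
Qed.

(** The difference [phi (x - y)] lies in the image and is orthogonal to it, hence to itself, so it
    vanishes; [phi] is injective on its image. *)
Lemma core_equation_inj x y : range phi x -> range phi y ->
  orthocomp g (range phi) (phi x - phi y) -> x = y.
Proof.
move=> Rx Ry orth_xy; have [_ injphi _] := AST_automorphism_W AST_phi.
apply: injphi; rewrite ?inE //; apply/eqP; rewrite -subr_eq0; apply/eqP.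
by apply/dot_self_eq0/orth_xy; exists (x - y); rewrite ?linearB.
Qed.

Lemma core_inverse_exists : exists chi, is_core_inverse g phi chi.
Proof.
have [_ _ surjphi] := AST_automorphism_W AST_phi.
have ex_chi v : exists x,
    range phi x /\ orthocomp g (range phi) (v - phi x).
  have [p Rp orth_p] := orthogonal_projection_exists v
    (AST_subspace_W AST_phi) (AST_finite_dim_W AST_phi).
  by have [x Rx def_p] := surjphi _ Rp; exists x; rewrite def_p.
have [chi chiP] := choice ex_chi.
have lin_chi : linear chi.
  move=> a u v; have [Ru orth_u] := chiP u; have [Rv orth_v] := chiP v.
  have [Rauv orth_auv] := chiP (a *: u + v).
  apply: core_equation_inj => //; first exact: range_linear.
  (* Linearity comes from uniqueness: [a *: chi u + chi v] solves the equation that defines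
     [chi (a *: u + v)]. Subtracting the residuals cancels [a *: u + v]. *)
  have := orthocomp_lin (-1) orth_auv (orthocomp_lin a orth_u orth_v).
  congr (orthocomp _ _ _); rewrite linearP /= scaleN1r opprB scalerBr.
  by rewrite [_ + (v - _)]addrACA -opprD addrA subrK.
pose chiL : {linear V -> V} :=
  HB.pack chi (GRing.isLinear.Build _ _ _ _ chi lin_chi).
exists chiL; split=> [v | _ [v _ <-]]; last by case: (chiP v).
by split; [exists (chi v) | case: (chiP v)].
Qed.

Variable chi : {linear V -> V}.
Hypothesis chiP : is_core_inverse g phi chi.

(** Both [x] and [chi (phi x)] solve the core equation for [phi x]. *)
Lemma core_inverse_range x : range phi x -> chi (phi x) = x.
Proof.
move=> Rx; have [proj sub_chi] := chiP.
apply: core_equation_inj => //; first by apply: sub_chi; exists (phi x).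
have [_ /(orthocomp_lin (-1) (y := 0))] := proj (phi x).
by rewrite addr0 scaleN1r opprB; apply=> s _; rewrite linear0l.
Qed.

Lemma core_inverse_eq0 v : chi v = 0 <-> orthocomp g (range phi) v.
Proof.
have [proj sub_chi] := chiP; have [_ orth_v] := proj v.
split=> [chiv0 | perp_v].
  by rewrite /= chiv0 linear0 subr0 in orth_v.
have R0 : range phi 0 by exists 0; rewrite ?linear0.
(* When [v] is orthogonal to the image, 0 solves the core equation for [v]. *)
apply: core_equation_inj => //; first by apply: sub_chi; exists v.
have := orthocomp_lin (-1) orth_v perp_v.
by rewrite scaleN1r opprB linear0 subr0 subrK.
Qed.

End CoreInverse.

Lemma core_le_iff (phi psi : {linear V -> V}) :
  AST_decomposition phi (range phi) (ker phi) ->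
  core_le g phi psi <->
    {in range phi, phi =1 psi} /\
    psi @` ker phi `<=` orthocomp g (range phi).
Proof.
move=> AST_phi; split=> [[chi [chiP eq_l eq_r]] | [eq_phi sub_ker]].
  split=> [x /set_mem Rx | _ [u phiu0 <-]].
    (* Writing [x] as [chi (phi x)] turns the goal into the first equation at [phi x]. *)
    by rewrite -(core_inverse_range AST_phi chiP Rx); exact: eq_l.
  apply/(core_inverse_eq0 AST_phi chiP).
  by have := eq_r u; rewrite /= phiu0 linear0 => <-.
have [chi chiP] := core_inverse_exists AST_phi.
exists chi; split=> // v.
  by apply: eq_phi; rewrite inE; apply: (proj2 chiP); exists v.
(* The second equation is checked on each summand: on [w] by agreement of [phi] and [psi], on [u]
   because [chi] kills [psi u]. *)
have [w Rw [u phiu0 ->]] := proj1 (AST_direct_sum AST_phi) v.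
rewrite /= !linearD /= phiu0 linear0 eq_phi ?inE //.
congr (_ + _); apply/esym/(core_inverse_eq0 AST_phi chiP).
by apply: sub_ker; exists u.
Qed.

End InnerProduct.

Theorem theorem5p4 (R : realType) (k : scalar_kind)
    (V : lmodType (scalars R k)) (g : {dot V for @scalar_conj R k})
    (phi psi : {linear V -> V})
    (fp_phi : finite_potent phi) (fp_psi : finite_potent psi)
    (i j : nat)
    (index_phi : has_index phi i) (i_le1 : (i <= 1)%N)
    (index_psi : has_index psi j) (j_le1 : (j <= 1)%N)
    (W U : set V) (AST_phi : AST_decomposition phi W U) :
  core_le g phi psi <->
    {in range phi, phi =1 psi} /\
    psi @` ker phi `<=` orthocomp g (range phi).
Proof.
exact/core_le_iff/(AST_decomposition_index_le1 index_phi i_le1).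
Qed.
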